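(* Let $k$ be any field, $\overline{k}$ a fixed algebraic closure, and $p$ a prime number. Let $k^{[p]} = k(\beta \in \overline{k} : [k(\beta):k] = p)$. Then $k^{[p]}$ is Galois bounded over $k$. More precisely, every finite Galois extension $K/k$ with $K \subseteq k^{[p]}$ is generated over $k$ by elements of degree at most $p$ over $k$.
   Context: An algebraic extension $M$ of $k$ is called Galois bounded over $k$ if there is a constant $c$ such that every finite Galois extension $K/k$ with $K \subseteq M$ is generated over $k$ by elements of degree at most $c$ over $k$. *)

(* Defs.v *)
(* Mathematical Components.

   The field kbar is a closedFieldType with a ring morphism iota : k -> kbar
   over which it is algebraic.  It has infinite degree over k in general, so its
   subfields are Prop-valued predicates.  Finite extensions of k are library
   fieldExtType's, embedded in kbar by ring morphisms that extend iota. *)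
From HB Require Import structures.
From mathcomp Require Import all_boot all_order all_algebra all_fingroup all_field.

Set Implicit Arguments.
Unset Strict Implicit.
Unset Printing Implicit Defensive.

Import GRing.Theory.
Local Open Scope ring_scope.

Section Subextensions.

Variables (k : fieldType) (kbar : fieldType) (iota : {rmorphism k -> kbar}).
Implicit Types (A M : kbar -> Prop) (x y : kbar).

Record subextension M : Prop := Subextension {
  subextension_base : forall a : k, M (iota a);
  subextension_sub : forall x y, M x -> M y -> M (x - y);
  subextension_mul : forall x y, M x -> M y -> M (x * y);
  subextension_inv : forall x, M x -> M x^-1
}.

Definition adjoin A : kbar -> Prop := fun x =>
  forall M, subextension M -> (forall y, A y -> M y) -> M x.

(* [M : k] = n: there is a k-basis of M with n elements. *)
Definition has_degree M (n : nat) : Prop :=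
  exists b : 'I_n -> kbar,
    (forall x, M x <-> exists c : 'I_n -> k, x = \sum_(i < n) iota (c i) * b i)
    /\ (forall c : 'I_n -> k,
          \sum_(i < n) iota (c i) * b i = 0 -> forall i, c i = 0).

Definition degree_compositum (p : nat) : kbar -> Prop :=
  adjoin (fun beta => has_degree (adjoin (eq beta)) p).

(* A splittingFieldType over k is finite and normal over k by construction, so
   [galois 1 {:K}] says that K / k is a finite Galois extension.  The dimension
   of <<1; x>> over k is [k(x) : k]. *)
Definition galois_generated_le M (c : nat) : Prop :=
  forall (K : splittingFieldType k) (j : {rmorphism K -> kbar}),
    (forall a : k, j a%:A = iota a) ->
    galois 1 {:K} ->
    (forall x : K, M (j x)) ->
  exists s : seq K,
    <<1 & s>>%VS = {:K}%VS /\ {in s, forall x : K, (\dim <<1; x>> <= c)%N}.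

Definition galois_bounded M : Prop :=
  [/\ subextension M,
      forall x, M x -> algebraicOver iota x
    & exists c : nat, galois_generated_le M c].

End Subextensions.

(* Main.v *)
(* Embed K in a normal extension L of k, inside kbar, that contains finitely
   many betas of degree p generating a field that contains K, and let G be the
   automorphism group of L / k.  A beta of degree p is separable or purely
   inseparable, so an element of G lying in all subgroups of index p fixes every
   beta, hence K.  By Galois theory it remains to prove: if N is normal in a
   finite group G and contains the intersection of all subgroups of index p,
   then N is an intersection of subgroups of index at most p.

   One may assume that the intersection of the subgroups of index p is trivial,
   so that G is a subdirect product of transitive groups G / M of degree p.  Such
   a group has a self-centralizing Sylow p-subgroup of order p, contained in
   every nontrivial normal subgroup.  In particular the Sylow p-subgroup P of G
   is elementary abelian, and 'N_G(P) / P is abelian of exponent dividing p - 1.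
   Given x outside N, enlarge N to a maximal normal subgroup avoiding x.  If
   P <= N, then by Frattini G / N is abelian of exponent dividing p - 1 and has a
   least nontrivial subgroup, so |G : N| < p.  If not, either N is contained in
   one of the M, and a point stabilizer for G / M separates x from N; or x lies
   in a normal subgroup of order p of G / N, which has a complement by Gaschutz
   because P is elementary abelian. *)
Require Import Defs.
From Stdlib Require Import Classical_Prop.
From HB Require Import structures.
From mathcomp Require Import all_boot all_order all_algebra all_fingroup.
From mathcomp Require Import all_solvable all_field.

Set Implicit Arguments.
Unset Strict Implicit.
Unset Printing Implicit Defensive.

(** * Finite groups: subgroups of prime index *)

Section IndexPrime.

Local Open Scope group_scope.

(** The action of [G] on the right cosets of [H] has kernel [gcore H G], so the quotient by it
    embeds in the symmetric group on these cosets. *)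
Lemma index_gcore_dvd_fact (gT : finGroupType) (G H : {group gT}) :
  #|G : gcore H G| %| #|G : H|`!.
Proof.
have nSG := actsRs_rcosets H G.
have sfS : actperm <[nSG]> @* G \subset perm.Sym (rcosets H G).
  apply/subsetP=> _ /morphimP[x _ _ ->]; rewrite inE.
  apply/subsetP=> u; rewrite inE; apply: contraR => Su.
  by rewrite actpermE /= /actby (negPf Su).
have := cardSg sfS; rewrite perm.card_Sym /= card_morphim ker_actperm astab_actby.
by rewrite setIT astabRs_rcosets setIid indexgI.
Qed.

Variables (gT : finGroupType) (p : nat) (G H P : {group gT}).
Hypotheses (p_pr : prime p) (sHG : H \subset G) (iHG : #|G : H| = p).
Hypotheses (coreH : gcore H G = 1) (sylP : p.-Sylow(G) P).

(** The order of [G] divides the factorial of [p], in which [p] occurs exactly once, and it is a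
    multiple of the index [p]. *)
Lemma card_Sylow_corefree : #|P| = p.
Proof.
have := index_gcore_dvd_fact G H; rewrite coreH indexg1 iHG => oG_dvd.
have lG : (logn p #|G| <= 1)%N.
  apply: leq_trans (dvdn_leq_log _ (fact_gt0 _) oG_dvd) _.
  have p_gt0 := prime_gt0 p_pr.
  rewrite -(prednK p_gt0) factS (prednK p_gt0) lognM ?fact_gt0 //.
  rewrite (logn_prime _ p_pr) eqxx (logn_fact _ p_pr).
  rewrite big_nat big1 // => k /andP[k_gt0 _]; rewrite divn_small //.
  by rewrite prednK // -{1}(expn1 p) leq_pexp2l.
have pG : p %| #|G| by rewrite -iHG dvdn_indexg.
rewrite (card_Hall sylP) p_part (_ : logn p _ = 1%N) ?expn1 //.
by apply/eqP; rewrite eqn_leq lG logn_gt0 mem_primes p_pr cardG_gt0.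
Qed.

Lemma corefree_mulG : H * P = G.
Proof.
have [sPG _ p'i] := and3P sylP.
by apply: coprime_index_mulG => //; rewrite iHG prime_coprime // -p'natE.
Qed.

(** As [H * P = G], every conjugate of [H] is a conjugate by an element of [P], so [H :&: 'C_G(P)]
    lies in the core and is trivial. Dedekind's law then leaves only [P]. *)
Lemma cent_Sylow_corefree : 'C_G(P) = P.
Proof.
have cPP : abelian P.
  by rewrite cyclic_abelian // prime_cyclic // card_Sylow_corefree.
have sPC : P \subset 'C_G(P) by rewrite subsetI (pHall_sub sylP).
have tiHC : H :&: 'C_G(P) = 1.
  apply/trivgP; rewrite -coreH; apply/subsetP=> c /setIP[Hc /setIP[Gc cPc]].
  apply/bigcapP=> _ /[1!(esym corefree_mulG)] /mulsgP[h a Hh Pa ->].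
  rewrite mem_conjg invMg conjgM memJ_norm ?(subsetP (normG H)) ?groupV //.
  by have /commgP/conjg_fixP-> := centP cPc _ (groupVr Pa).
rewrite -[LHS](setIidPr (subsetIl G _)) -{1}corefree_mulG setIC.
by rewrite -group_modr // setIC tiHC mul1g.
Qed.

(** A nontrivial normal [X] is not inside [H], so [H <*> X = G] and [p] divides [#|X|]. A subgroup
    of order [p] in [X] is then a conjugate of [P]. *)
Lemma normal_corefree_Sylow (X : {group gT}) :
  X <| G -> X :!=: 1 -> P \subset X.
Proof.
move=> nsXG ntX; have [sXG nXG] := andP nsXG.
have sHXG : H <*> X \subset G by rewrite join_subG sHG.
have HXE : H <*> X = G.
  have iHX : #|H <*> X : H| %| p.
    by rewrite -iHG -(Lagrange_index sHXG) ?joing_subl ?dvdn_mull.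
  have [_ /(_ _ iHX)/orP[|/eqP iHXp]] := primeP p_pr.
    rewrite indexg_eq1 join_subG => /andP[_ sXH].
    by case/negP: ntX; rewrite -subG1 -coreH gcore_max.
  apply/eqP; rewrite eqEcard sHXG -(Lagrange sHG).
  by rewrite -(Lagrange (joing_subl H X)) iHXp iHG /=.
have [y Xy oy] : {y | y \in X & #[y] = p}.
  apply: Cauchy => //; rewrite -{1}iHG -HXE norm_joinEl ?(subset_trans sHG) //.
  by rewrite indexMg -indexgI dvdn_indexg.
have [g Gg sygP] : exists2 g, g \in G & <[y]> \subset P :^ g.
  apply: Sylow_subJ sylP _ _; first by rewrite cycle_subG (subsetP sXG).
  by rewrite /pgroup -orderE oy pnat_id.
have yP : <[y]> = P :^ g.
  by apply/eqP; rewrite eqEcard sygP cardJg card_Sylow_corefree -orderE oy /=.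
by rewrite -(conjSg _ _ g) (normP (subsetP nXG g Gg)) -yP cycle_subG.
Qed.

(** Modulo ['C_G(P) = P], the normalizer embeds in [Aut P], which is cyclic of order [p.-1]. The
    next lemma rests on the same fact. *)
Lemma comm_norm_Sylow_corefree (x y : gT) :
  x \in 'N_G(P) -> y \in 'N_G(P) -> [~ x, y] \in P.
Proof.
move=> /setIP[Gx nPx] /setIP[Gy nPy]; rewrite -cent_Sylow_corefree.
rewrite inE groupR //= -ker_conj_aut; apply/kerP; first by rewrite groupR.
have cAA : abelian (Aut P).
  by rewrite cyclic_abelian ?Aut_prime_cyclic ?card_Sylow_corefree.
have AutP z : z \in 'N(P) -> conj_aut P z \in Aut P.
  by move=> nPz; apply: (subsetP (Aut_conj_aut P 'N(P))); rewrite mem_morphim.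
by rewrite morphR //; apply/eqP/commgP; apply: (centsP cAA); apply: AutP.
Qed.

Lemma expg_norm_Sylow_corefree (x : gT) : x \in 'N_G(P) -> x ^+ p.-1 \in P.
Proof.
move=> /setIP[Gx nPx]; rewrite -cent_Sylow_corefree.
rewrite inE groupX //= -ker_conj_aut; apply/kerP; first by rewrite groupX.
have oA : #|Aut P| = p.-1.
  by rewrite card_Aut_cyclic ?prime_cyclic // card_Sylow_corefree // totient_prime.
rewrite morphX // -oA expg_cardG //.
by apply: (subsetP (Aut_conj_aut P 'N(P))); rewrite mem_morphim.
Qed.

End IndexPrime.

(** * Transfer of the core-free case to the quotient by the core *)

Section QuotientByCore.

Local Open Scope group_scope.

Variables (gT : finGroupType) (p : nat) (G H P : {group gT}).
Hypotheses (p_pr : prime p) (sHG : H \subset G) (iHG : #|G : H| = p).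
Hypothesis sylP : p.-Sylow(G) P.

Local Notation M := (gcore_group H G).

Let nsMG : M <| G. Proof. exact: gcore_normal. Qed.
Let nMG : G \subset 'N(M). Proof. exact: gcore_norm. Qed.
Let sPG : P \subset G. Proof. exact: pHall_sub sylP. Qed.
Let nMP : P \subset 'N(M). Proof. exact: subset_trans sPG nMG. Qed.

Let sHMG : H / M \subset G / M. Proof. exact: quotientS. Qed.

Let coreHM : gcore (H / M) (G / M) = 1.
Proof.
have [Y defY sMY nsYG] := inv_quotientN nsMG (gcore_normal sHMG).
have nMY := subset_trans (normal_sub nsYG) nMG.
have: Y / M \subset H / M by rewrite -defY gcore_sub.
rewrite quotientSGK ?gcore_sub // => sYH; rewrite [LHS]defY.
by apply/trivgP; rewrite quotient_sub1 // gcore_max // normal_norm.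
Qed.

Let iHMG : #|G / M : H / M| = p.
Proof. by rewrite index_quotient_eq ?iHG // subIset ?gcore_sub ?orbT. Qed.

Let sylPM : p.-Sylow(G / M) (P / M).
Proof. by rewrite quotient_pHall. Qed.

Let oPM : #|P / M| = p.
Proof. exact: card_Sylow_corefree p_pr iHMG coreHM sylPM. Qed.

Let cPMPM : abelian (P / M).
Proof. by rewrite cyclic_abelian // prime_cyclic // oPM. Qed.

Lemma normal_Sylow_gcore (X : {group gT}) :
  X <| G -> ~~ (X \subset M) -> P \subset M * X.
Proof.
move=> nsXG nsXM; have nMX := subset_trans (normal_sub nsXG) nMG.
rewrite -quotientSK //.
apply: (normal_corefree_Sylow p_pr sHMG iHMG coreHM sylPM).
  exact: quotient_normal.
by apply: contra nsXM => /eqP XM1; rewrite -quotient_sub1 // XM1.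
Qed.

(** The abelian group [D / M] contains [P / M], hence centralizes it; as [P / M] is its own
    centralizer, the two coincide. *)
Lemma normal_abelian_gcore (D : {group gT}) :
    D <| G -> ~~ (D \subset M) -> abelian (D / M) -> #|D : D :&: M| = p.
Proof.
move=> nsDG nsDM cDD; have nMD := subset_trans (normal_sub nsDG) nMG.
have sPMD : P / M \subset D / M.
  by rewrite quotientSK // normal_Sylow_gcore.
have sDMP : D / M \subset P / M.
  rewrite -(cent_Sylow_corefree p_pr sHMG iHMG coreHM sylPM).
  by rewrite subsetI quotientS ?(subset_trans cDD (centS sPMD)) ?(normal_sub nsDG).
by rewrite indexgI -card_quotient // -oPM; apply/eqP; rewrite eqn_leq !subset_leq_card.
Qed.

Lemma expg_Sylow_gcore x : x \in P * M -> x ^+ p \in M.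
Proof.
rewrite -norm_joinEl // => PMx.
have nMPM : P <*> M \subset 'N(M) by rewrite join_subG nMP normG.
have nMx := subsetP nMPM x PMx.
apply: coset_idr; first by rewrite groupX.
rewrite morphX // -oPM expg_cardG //.
by have:= mem_quotient M PMx; rewrite quotientYidr.
Qed.

Lemma comm_Sylow_gcore x y : x \in P -> y \in P -> [~ x, y] \in M.
Proof.
move=> Px Py; have [nMx nMy] := (subsetP nMP x Px, subsetP nMP y Py).
apply: coset_idr; first by rewrite groupR.
rewrite morphR //; apply/eqP/commgP.
by apply: (centsP cPMPM); apply: mem_quotient.
Qed.

Let mem_PM x : x \in G -> coset M x \in P / M -> x \in P * M.
Proof.
move=> Gx PMx; have nMx := subsetP nMG x Gx.
have: x \in coset M @*^-1 (P / M) by rewrite mem_morphpre.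
by rewrite quotientK // (normC nMP).
Qed.

Lemma comm_norm_Sylow_gcore x y :
  x \in 'N_G(P) -> y \in 'N_G(P) -> [~ x, y] \in P * M.
Proof.
move=> NPx NPy; have nMN : 'N_G(P) \subset 'N(M) by rewrite subIset ?nMG.
have sNN : 'N_G(P) / M \subset 'N_(G / M)(P / M).
  by rewrite subsetI quotientS ?subsetIl ?quotient_norms ?subsetIr.
have [/setIP[Gx _] /setIP[Gy _]] := (NPx, NPy).
apply: mem_PM; rewrite ?groupR // morphR ?(subsetP nMN) //.
apply: (comm_norm_Sylow_corefree p_pr sHMG iHMG coreHM sylPM);
  by apply: (subsetP sNN); rewrite mem_quotient.
Qed.

Lemma expg_norm_Sylow_gcore x : x \in 'N_G(P) -> x ^+ p.-1 \in P * M.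
Proof.
move=> NPx; have nMN : 'N_G(P) \subset 'N(M) by rewrite subIset ?nMG.
have sNN : 'N_G(P) / M \subset 'N_(G / M)(P / M).
  by rewrite subsetI quotientS ?subsetIl ?quotient_norms ?subsetIr.
have /setIP[Gx _] := NPx.
apply: mem_PM; rewrite ?groupX // morphX ?(subsetP nMN) //.
apply: (expg_norm_Sylow_corefree p_pr sHMG iHMG coreHM sylPM).
by apply: (subsetP sNN); rewrite mem_quotient.
Qed.

End QuotientByCore.

(** * Separating a point from a normal subgroup *)

Section SmallIndex.

Local Open Scope group_scope.

(** If [A] is not cyclic, it contains an elementary abelian [E] of rank 2. A complement of [<[x]>]
    in [E] is nontrivial, so it contains [x], which is absurd. Thus [A] is cyclic and its order is
    its exponent. *)
Lemma leq_card_abelian_monolith (gT : finGroupType) (A : {group gT}) x n :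
    abelian A -> (0 < n)%N -> exponent A %| n -> x != 1 ->
    (forall B : {group gT}, B \subset A -> B :!=: 1 -> x \in B) ->
  (#|A| <= n)%N.
Proof.
move=> cAA n_gt0 eAn ntx monoA; suff cycA : cyclic A.
  by rewrite -exponent_cyclic // dvdn_leq.
rewrite abelian_rank1_cyclic // leqNgt; apply/negP.
have [q q_pr ->] := rank_witness A => /p_rank_geP[E /pnElemP[sEA abelE dimE]].
have ntE : E :!=: 1 by apply: contra_eqN dimE => /eqP->; rewrite cards1 logn1.
have Ex := monoA E sEA ntE.
have sxE : <[x]> \subset E by rewrite cycle_subG.
have /splitsP[B /complP[tixB defE]] := abelem_splits abelE sxE.
have [B1|ntB] := eqVneq (B : {set gT}) 1.
  move: dimE; rewrite -defE B1 mulg1 -orderE (abelem_order_p abelE Ex ntx).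
  by rewrite (logn_prime _ q_pr) eqxx.
have sBE : B \subset E by rewrite -defE mulG_subr.
have Bx := monoA B (subset_trans sBE sEA) ntB.
by case/negP: ntx; rewrite -in_set1 -[[set 1]]tixB inE cycle_id.
Qed.

Variables (gT : finGroupType) (p : nat) (G : {group gT}).
Hypothesis p_pr : prime p.
Implicit Types H K N P : {group gT}.

Section TrivialIntersection.

Hypothesis triv_index_p : forall g : gT, g \in G ->
  (forall H, H \subset G -> #|G : H| = p -> g \in gcore H G) -> g = 1.

Variable P : {group gT}.
Hypothesis sylP : p.-Sylow(G) P.
Let sPG : P \subset G := pHall_sub sylP.

Lemma abelem_Sylow_index_p : p.-abelem P.
Proof.
rewrite abelemE //; apply/andP; split.
  apply/centsP=> x Px y Py; apply/commgP/eqP; apply: triv_index_p.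
    by rewrite groupR ?(subsetP sPG).
  by move=> H sHG iHG; apply: comm_Sylow_gcore iHG sylP _ _ Px Py.
apply/exponentP=> x Px; apply: triv_index_p.
  by rewrite groupX ?(subsetP sPG).
move=> H sHG iHG; apply: (expg_Sylow_gcore p_pr sHG iHG sylP).
by rewrite -[x]mulg1 mem_mulg.
Qed.

(** Here [x ^+ p] lies in every core, so it is trivial, and the [p]-elements of ['N_G(P)] lie in its
    normal Sylow subgroup [P]. *)
Lemma mem_norm_Sylow_index_p x : x \in 'N_G(P) ->
  (forall H, H \subset G -> #|G : H| = p -> x \in P * gcore H G) -> x \in P.
Proof.
move=> NPx PMx; have /setIP[Gx _] := NPx.
have nsPN : P <| 'N_G(P) by rewrite normalSG.
have sylPN : p.-Sylow('N_G(P)) P.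
  by apply: pHall_subl sylP; rewrite ?subsetIl ?normal_sub.
rewrite (mem_normal_Hall sylPN nsPN NPx) /p_elt.
apply: (@pnat_dvd _ p); last by rewrite pnat_id.
rewrite order_dvdn; apply/eqP/triv_index_p; first by rewrite groupX.
by move=> H sHG iHG; apply: (expg_Sylow_gcore p_pr sHG iHG sylP); apply: PMx.
Qed.

Variables (N : {group gT}) (x : gT).
Hypotheses (nsNG : N <| G) (Gx : x \in G) (N'x : x \notin N).
(** This is how the maximality of [N] among normal subgroups avoiding [x] is used: [K * N] is normal
    and larger than [N]. *)
Hypothesis maxN : forall K, K <| G -> ~~ (K \subset N) -> x \in K * N.

Lemma index_Sylow_sub : P \subset N -> (#|G : N| <= p)%N.
Proof.
move=> sPN; have [sNG nNG] := andP nsNG.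
have sylPN : p.-Sylow(N) P by apply: pHall_subl sylP.
have defG : N * 'N_G(P) = G by apply: Frattini_arg nsNG sylPN.
have eqGN : G / N = 'N_G(P) / N by rewrite -[in LHS]defG quotientMidl.
(* The bound obtained is in fact [p.-1], a multiple of the exponent of [G / N]. *)
rewrite -card_quotient //; apply: leq_trans (leq_pred p).
have cGN : abelian (G / N).
  rewrite eqGN; apply: quotient_cents2r; rewrite gen_subG.
  apply/subsetP=> _ /imset2P[a b Na Nb ->]; apply: (subsetP sPN).
  apply: mem_norm_Sylow_index_p; first by rewrite groupR.
  by move=> H sHG iHG; apply: (comm_norm_Sylow_gcore p_pr sHG iHG sylP).
apply: (@leq_card_abelian_monolith _ _ (coset N x)) => //.
- by rewrite -subn1 subn_gt0 prime_gt1.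
- apply/exponentP=> y GNy; have: y \in 'N_G(P) / N by rewrite -eqGN.
  case/morphimP=> a Na NPa ->.
  rewrite -morphX //; apply: coset_id; apply: (subsetP sPN).
  apply: mem_norm_Sylow_index_p; first by rewrite groupX.
  by move=> H sHG iHG; apply: (expg_norm_Sylow_gcore p_pr sHG iHG sylP).
- by apply: contra N'x => /eqP/coset_idr->; rewrite ?(subsetP nNG).
(* Subgroups of the abelian [G / N] are normal, so the preimage [K] of [B] is normal in [G] and not
   inside [N]; then [maxN] puts [x] in [K * N = K]. *)
move=> B sBGN ntB; have nsBGN : B <| G / N by rewrite -sub_abelian_normal.
have [K defB sNK nsKG] := inv_quotientN nsNG nsBGN.
have nNK := subset_trans (normal_sub nsKG) nNG.
have: x \in K * N.
  apply: maxN => //; apply: contra ntB; rewrite defB => sKN.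
  by rewrite -subG1 quotient_sub1.
by rewrite mulGSid // => Kx; rewrite defB mem_quotient.
Qed.

(** The image of [D] in [G / N] is normal of order [p]. The elementary abelian Sylow subgroup splits
    over it, hence so does [G / N] by Gaschutz. A complement misses the image of [x], which is
    nontrivial and lies in that of [D]. *)
Lemma normal_compl_Sylow (D : {group gT}) :
    D <| G -> #|D : D :&: N| = p -> x \in D * N ->
  exists H, [/\ N \subset H, H \subset G, #|G : H| = p & x \notin H].
Proof.
move=> nsDG iDN DNx; have [sNG nNG] := andP nsNG.
have nND : D \subset 'N(N) := subset_trans (normal_sub nsDG) nNG.
have nNP : P \subset 'N(N) := subset_trans sPG nNG.
have oDN : #|D / N| = p by rewrite card_quotient // -indexgI.
have sylPN : p.-Sylow(G / N) (P / N) by rewrite quotient_pHall.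
have nsDNG : D / N <| G / N by apply: quotient_normal.
have sDPN : D / N \subset P / N.
  by apply: (normal_sub_max_pgroup (Hall_max sylPN)); rewrite ?/pgroup ?oDN ?pnat_id.
have: [splits G / N, over D / N].
  rewrite (Gaschutz_split nsDNG sDPN (pHall_sub sylPN)).
  - exact: abelem_splits (quotient_abelem _ abelem_Sylow_index_p) sDPN.
  - by rewrite cyclic_abelian // prime_cyclic ?oDN.
  by rewrite oDN prime_coprime // -p'natE //; have [] := and3P sylPN.
case/splitsP=> K /complP[tiDK defGN].
have sKGN : K \subset G / N by rewrite -defGN mulG_subr.
have [H defK sNH sHG] := inv_quotientS nsNG sKGN.
exists H; split=> //.
  rewrite -(index_quotient_eq _ sHG nNG) ?subIset ?sNH ?orbT // -defK.
  by rewrite -divgS //= -defGN TI_cardMg // mulnK ?cardG_gt0.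
apply: contra N'x => Hx; apply: coset_idr; first exact: subsetP Gx.
apply/set1P; rewrite -[[set 1]]tiDK inE defK (mem_quotient N Hx) andbT.
case/mulsgP: DNx => d n Dd Nn ->.
have [nNd nNn] := (subsetP nND d Dd, subsetP (normG N) n Nn).
by rewrite morphM // [X in _ * X](coset_id Nn) mulg1 mem_quotient.
Qed.

Lemma exists_index_p : ~~ (P \subset N) ->
  exists H, [/\ N \subset H, H \subset G, #|G : H| = p & x \notin H].
Proof.
move=> nsPN; have [sNG nNG] := andP nsNG.
(* [R] is the normal closure of [P] in [G]. *)
pose R := <<class_support P G>>%G.
have nsRG : R <| G.
  rewrite /R /normal /= gen_subG class_support_subG //.
  by rewrite norms_gen // class_support_norm.
have sPR : P \subset R by rewrite sub_gen // sub_class_support.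
have minR (X : {group gT}) : X <| G -> P \subset X -> R \subset X.
  by case/andP=> sXG nXG sPX; rewrite /R /= gen_subG class_support_sub_norm.
pose D (S : {set {group gT}}) := (R :&: \bigcap_(H in S) gcore_group H G)%G.
pose J := [set H : {group gT} | (H \subset G) && (#|G : H| == p)].
have nsDG (S : {set {group gT}}) : D S <| G.
  rewrite /normal subIset ?(normal_sub nsRG) //=.
  rewrite normsI ?(normal_norm nsRG) //; apply: norms_bigcap.
  by apply/bigcapsP=> H _; apply: gcore_norm.
have DJ : D J \subset N.
  apply/subsetP=> g /setIP[Rg /bigcapP Jg]; rewrite (triv_index_p (g := g)) ?group1 //.
    by rewrite (subsetP (normal_sub nsRG)).
  by move=> H sHG iHG; apply: Jg; rewrite inE sHG iHG eqxx.
(* Dropping one of the cores M from a minimal S with D S \subset N gives E with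
   E :&: M \subset N but not E \subset N.  Restricting D to R, the least normal
   subgroup containing P, yields the converse inclusion E :&: N \subset M. *)
have [S /minsetP[DS minS] sSJ] := @minset_exists _ (fun S => D S \subset N) J DJ.
have [S0|[H SH]] := set_0Vmem S.
  case/negP: nsPN; apply: subset_trans DS; rewrite S0 /D /=.
  by rewrite big_set0 setIT.
have /[!inE]/andP[sHG /eqP iHG] := subsetP sSJ H SH.
pose E := D (S :\ H).
have nsEG : E <| G := nsDG _.
have nsEN : ~~ (E \subset N).
  apply/negP=> /minS; rewrite subsetDl => /(_ isT) SE.
  by move: SH; rewrite -SE !inE eqxx.
have sEM : E :&: gcore H G \subset N.
  apply/subsetP=> y /setIP[/setIP[Ry /bigcapP Dy] My].
  apply: (subsetP DS); rewrite inE Ry; apply/bigcapP=> K SK.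
  by have [-> // | nKH] := eqVneq K H; apply: Dy; rewrite !inE nKH.
set M := gcore_group H G in sEM; have nsMG : M <| G := gcore_normal sHG.
have nMG := normal_norm nsMG.
have nsEM : ~~ (E \subset M).
  by apply: contra nsEN => sE; rewrite -(setIidPl sE).
have Ex : x \in E * N := maxN nsEG nsEN.
(* The normal subgroup [M * X] contains [P], hence [R], hence [E]. *)
have subM (X : {group gT}) : X <| G -> ~~ (X \subset M) -> E \subset M * X.
  move=> nsXG nsXM; have nMX := subset_trans (normal_sub nsXG) nMG.
  rewrite -norm_joinEr //; apply: subset_trans (subsetIl _ _) _.
  apply: minR; first exact: normalY.
  by rewrite /= norm_joinEr // (normal_Sylow_gcore p_pr sHG iHG sylP nsXG nsXM).
(* Otherwise [E] lies in [M * (E :&: N)], so by Dedekind's law in [(E :&: M) * (E :&: N)], which is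
   inside [N]. *)
have sENM : E :&: N \subset M.
  apply: contraR nsEN => nsENM; have := subM _ (normalI nsEG nsNG) nsENM.
  move=> sE; rewrite -(setIidPl sE) -group_modr ?subsetIl //.
  by rewrite mul_subG ?subsetIr.
(* If [N] lies in [M], write [x] as [d * n] with [d] in [E] and [n] in [N]. Were [x] in the core,
   [d] would be in [E :&: M], hence [x] in [N]. So some conjugate of [H] misses [x]. *)
have [sNM|nsNM] := boolP (N \subset M).
  have: x \notin gcore H G.
    apply: contra N'x; case/mulsgP: Ex => d n Ed Nn ->.
    by rewrite !groupMr ?(subsetP sNM n Nn) // => Md; rewrite (subsetP sEM) // inE Ed.
  have [/forall_inP Hx | ] := boolP [forall g in G, x \in H :^ g].
    by case/negP; apply/bigcapP.
  rewrite negb_forall_in => /exists_inP[g Gg H'x] _; exists (H :^ g)%G; split=> //.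
  - by apply: subset_trans sNM _; apply: bigcap_inf.
  - by rewrite -(conjGid Gg) conjSg.
  by rewrite -{1}(conjGid Gg) indexJg.
(* Otherwise [E / M] lies in [N / M], and it centralizes [N / M] because [[~: E, N]] lies in
   [E :&: N], inside [M]. *)
have cEE : abelian (E / M).
  have sEN : E / M \subset N / M.
    by rewrite quotientSK ?subM // (subset_trans _ nMG) ?normal_sub.
  apply: subset_trans (centS sEN); apply: quotient_cents2r.
  apply: subset_trans sENM; rewrite subsetI commg_subl commg_subr.
  by rewrite (subset_trans sNG (normal_norm nsEG)) (subset_trans (normal_sub nsEG)).
have iEM := normal_abelian_gcore p_pr sHG iHG sylP nsEG nsEM cEE.
apply: (normal_compl_Sylow nsEG _ Ex); rewrite -iEM.
have -> // : E :&: N = E :&: M.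
by apply/eqP; rewrite eqEsubset; apply/andP; split; rewrite subsetI subsetIl ?sENM ?sEM.
Qed.

End TrivialIntersection.

Lemma separate_small_index_trivial N x :
    (forall g, g \in G ->
       (forall H, H \subset G -> #|G : H| = p -> g \in gcore H G) -> g = 1) ->
    N <| G -> x \in G -> x \notin N ->
  exists H, [/\ N \subset H, H \subset G, (#|G : H| <= p)%N & x \notin H].
Proof.
move=> triv nsNG Gx N'x.
pose avoids K := [&& K <| G, N \subset K & x \notin K].
have [|K /maxgroupP[/and3P[nsKG sNK K'x] maxK] _] := @maxgroup_exists _ avoids N.
  by rewrite /avoids nsNG subxx.
have [P sylP] := Sylow_exists p G.
have max_mul (L : {group gT}) : L <| G -> ~~ (L \subset K) -> x \in L * K.
  move=> nsLG; apply: contraR => LK'x.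
  have LKE : L <*> K = L * K.
    by rewrite norm_joinEl // (subset_trans (normal_sub nsLG)) ?normal_norm.
  rewrite -(maxK (L <*> K)%G) ?joing_subl ?joing_subr //.
  by rewrite /avoids normalY //= LKE LK'x (subset_trans sNK) ?mulG_subr.
have [sPK|nsPK] := boolP (P \subset K).
  exists K; split=> //; first exact: normal_sub.
  exact: (index_Sylow_sub triv sylP nsKG Gx K'x).
have [H [sKH sHG iHG H'x]] := exists_index_p triv sylP nsKG Gx K'x max_mul nsPK.
by exists H; rewrite iHG leqnn (subset_trans sNK).
Qed.

End SmallIndex.

(** * Reduction to a trivial intersection *)

Section Separation.

Local Open Scope group_scope.

Lemma separate_small_index (gT : finGroupType) (p : nat) (G N : {group gT}) x :
    prime p ->
    (forall g, g \in G ->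
       (forall H : {group gT}, H \subset G -> #|G : H| = p -> g \in H) -> g \in N) ->
    N <| G -> x \in G -> x \notin N ->
  exists H : {group gT}, [/\ N \subset H, H \subset G, (#|G : H| <= p)%N & x \notin H].
Proof.
move=> p_pr meetN nsNG Gx N'x; have [sNG nNG] := andP nsNG.
pose J := [set H : {group gT} | (H \subset G) && (#|G : H| == p)].
(* The factor [G] keeps [F] inside [G] when [J] is empty. *)
pose F := (G :&: \bigcap_(H in J) gcore_group H G)%G.
have sFG : F \subset G := subsetIl _ _.
have nFG : G \subset 'N(F).
  rewrite normsI ?normG //; apply: norms_bigcap.
  by apply/bigcapsP=> H _; apply: gcore_norm.
have nsFG : F <| G by rewrite /normal sFG.
have sFH (H : {group gT}) : H \subset G -> #|G : H| = p -> F \subset H.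
  move=> sHG iHG; apply: subset_trans (gcore_sub H G).
  by rewrite subIset // (bigcap_inf H) ?orbT // inE sHG iHG eqxx.
have sFN : F \subset N.
  apply/subsetP=> g Fg; apply: meetN => [|H sHG iHG].
    exact: (subsetP sFG).
  exact: (subsetP (sFH H sHG iHG)).
have mem_cosetF (K : {group gT}) g :
    F \subset K -> K \subset G -> g \in G -> coset F g \in K / F -> g \in K.
  move=> sFK sKG Gg Kg; have nsFK := normalS sFK sKG nsFG.
  by rewrite -(quotientGK nsFK) mem_morphpre ?(subsetP nFG).
have [||||Hb [sNHb sHbG iHbG Hb'x]] :=
  @separate_small_index_trivial _ p (G / F)%G p_pr (N / F)%G (coset F x).
(* Each conjugate [H :^ y] again has index [p] and contains [F], so membership of [g] in it can be
   tested in [G / F]. *)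
- move=> _ /morphimP[g nFg Gg ->] coreg; apply: coset_id.
  rewrite inE Gg; apply/bigcapP=> H /[!inE]/andP[sHG /eqP iHG].
  apply/bigcapP=> y Gy.
  have sHyG : H :^ y \subset G by rewrite -(conjGid Gy) conjSg.
  have iHyG : #|G : H :^ y| = p by rewrite -{1}(conjGid Gy) indexJg.
  have sFHy := sFH (H :^ y)%G sHyG iHyG.
  have: coset F g \in (H :^ y)%G / F.
    apply: (subsetP (gcore_sub _ (G / F)%G)); apply: coreg; first exact: quotientS.
    by rewrite index_quotient_eq // subIset ?sFHy ?orbT.
  exact: mem_cosetF.
- exact: quotient_normal.
- exact: mem_quotient.
- by apply: contra N'x; apply: mem_cosetF.
have [H defHb sFH' sHG] := inv_quotientS nsFG sHbG.
have sNH : N \subset H.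
  by rewrite -(quotientSGK _ sFH') ?(subset_trans sNG) // -defHb.
exists H; split=> //.
  by rewrite -(index_quotient_eq _ sHG nFG) -?defHb // subIset ?sFH' ?orbT.
by apply: contra Hb'x => Hx; rewrite defHb mem_quotient.
Qed.

End Separation.

Import GRing.Theory.
Local Open Scope ring_scope.

(** * Field extensions *)

Section Extensions.

(** An annihilator of least size is irreducible; excluded middle decides whether a smaller one
    exists. *)
Lemma exists_irreducible_root (F Om : fieldType) (j : {rmorphism F -> Om}) z :
    algebraicOver j z ->
  exists2 q : {poly F}, irreducible_poly q & root (map_poly j q) z.
Proof.
case=> q nzq qz0; have [n leqn] := ubnP (size q).
elim: n => // n IHn in q nzq qz0 leqn *.
have [[r [nzr rz0 ltrq]] | min_q] :=
  classic (exists r, [/\ r != 0, root (map_poly j r) z & (size r < size q)%N]).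
  by apply: (IHn r) => //; apply: leq_trans ltrq _.
exists q => //; apply/(subfx_irreducibleP qz0 nzq) => r rz0 nzr.
by rewrite leqNgt; apply/negP=> ltrq; apply: min_q; exists r.
Qed.

(* The extension is built over K and then viewed as an extension of k. *)
Lemma exists_simple_extension (k Om : fieldType) (K : fieldExtType k)
    (j : {rmorphism K -> Om}) z : algebraicOver j z ->
  exists (L : fieldExtType k) (e : 'AHom(K, L)) (jL : {rmorphism L -> Om}) y,
    [/\ forall x, jL (e x) = j x, jL y = z
      & <<limg e; y>>%VS = {:L}%VS].
Proof.
case/exists_irreducible_root=> q irr_q qz0.
pose L0 : fieldExtType K := SubFieldExtType qz0 irr_q.
pose L : fieldExtType k := baseFieldType L0.
pose e0 : K -> L := in_alg L0.
have e0_lin : linear e0.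
  move=> a x y; rewrite /e0 /= scalerDl; congr (_ + _).
  by rewrite -[RHS]/(baseField_scale a _) /baseField_scale /= scalerA mulr_algl.
have e0_mul : monoid_morphism e0.
  by split=> [|x y]; [rewrite /e0 rmorph1 | rewrite /e0 rmorphM].
pose e0L := GRing.isLinear.Build _ _ _ _ e0 e0_lin.
pose e0M := GRing.isMonoidMorphism.Build _ _ _ e0_mul.
pose e0R : {lrmorphism K -> L} := HB.pack e0 e0L e0M.
have e0E x : linfun_ahom e0R x = x%:A :> L0 by exact: (lfunE e0R).
pose jL0 : {rmorphism L0 -> Om} := @subfx_inj K Om j z q.
pose jL : {rmorphism L -> Om} := jL0.
pose y : L := subfx_root j z q.
have jLy : jL y = z.
  by apply: subfx_inj_root => //; apply: irredp_neq0.
exists L, (linfun_ahom e0R), jL, y; split=> // [x|].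
  by rewrite e0E; apply: subfx_inj_base => //; apply: irredp_neq0.
apply/vspaceP=> u; rewrite memvf.
have [r Du] := subfxEroot qz0 (irredp_neq0 irr_q) u.
have Er : map_poly e0R r \is a polyOver <<limg (linfun_ahom e0R); y>>%VS.
  apply/polyOverP=> i; rewrite coef_map -[X in X \in _]e0E.
  by apply: (subvP (subv_adjoin _ _)); apply: memv_img; apply: memvf.
have -> : u = (map_poly e0R r).[y] by apply: Du.
exact: (rpred_horner Er (memv_adjoin _ _)).
Qed.

Lemma exists_extension (k Om : fieldType) (K : fieldExtType k)
    (j : {rmorphism K -> Om}) (zs : seq Om) :
    (forall z, algebraicOver j z) ->
  exists (L : fieldExtType k) (e : 'AHom(K, L)) (jL : {rmorphism L -> Om}) ys,
    [/\ forall x, jL (e x) = j x, map jL ys = zs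
      & <<limg e & ys>>%VS = {:L}%VS].
Proof.
move=> alg_j; elim/last_ind: zs => [|zs z [L1 [e1 [j1 [ys [j1e1 Dzs defL1]]]]]].
  exists K, \1%VF%AF, j, [::]; split=> // [x|]; first by rewrite lfunE.
  apply/eqP; rewrite eqEsubv subvf /=; apply/subvP=> x _.
  apply: (subvP (subv_adjoin_seq _ _)).
  by have := memv_img (\1%VF%AF : 'AHom(K, K)) (memvf x); rewrite lfunE.
have alg_z : algebraicOver j1 z.
  have [q nzq qz0] := alg_j z; exists (map_poly e1 q); first by rewrite map_poly_eq0.
  by rewrite -map_poly_comp (eq_map_poly j1e1).
have [L [e [jL [y [jLe jLy defL]]]]] := exists_simple_extension alg_z.
exists L, (e \o e1)%AF, jL, (rcons (map e ys) y); split=> [x||].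
- by rewrite comp_lfunE jLe j1e1.
- by rewrite map_rcons -map_comp (eq_map jLe) Dzs jLy.
by rewrite adjoin_rcons limg_comp -aimg_adjoin_seq defL1.
Qed.

(** To keep normality over [k], all roots of a polynomial [Q] over [k] that kills every member of
    [bs] are adjoined. [L] is then the splitting field of [Q] times a polynomial [q] with splitting
    field [K]. *)
Lemma exists_splitting_extension (k : fieldType) (Om : closedFieldType)
    (K : splittingFieldType k) (j : {rmorphism K -> Om}) (bs : seq Om) :
    (forall z, algebraicOver (j \o in_alg K) z) ->
  exists (L : splittingFieldType k) (e : 'AHom(K, L)) (jL : {rmorphism L -> Om}),
    (forall x, jL (e x) = j x) /\ (forall b, b \in bs -> exists y, jL y = b).
Proof.
move=> alg_j.
have [Q nzQ Qbs] : exists2 Q : {poly k}, Q != 0 &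
    forall b, b \in bs -> root (map_poly (j \o in_alg K) Q) b.
  elim: bs => [|b bs [Q nzQ Qbs]]; first by exists 1; rewrite ?oner_eq0.
  have [q nzq qb0] := alg_j b; exists (q * Q); first by rewrite mulf_neq0.
  move=> c; rewrite inE rmorphM rootM => /predU1P[-> | /Qbs ->]; last exact: orbT.
  by rewrite qb0.
have [zs DQ] := closed_field_poly_normal (map_poly (j \o in_alg K) Q).
have alg_jK z : algebraicOver j z.
  have [q nzq qz0] := alg_j z; exists (map_poly (in_alg K) q).
    by rewrite map_poly_eq0.
  by rewrite -map_poly_comp.
have [L [e [jL [ys [jLe Dzs defL]]]]] := exists_extension zs alg_jK.
have [q Kq [rs Dq defK]] := splittingFieldP K.
have Fq : map_poly e q \is a polyOver 1%VS.
  apply/polyOverP=> i; rewrite coef_map /=.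
  have /vlineP[a ->] := polyOverP Kq i.
  by rewrite linearZ /= rmorph1 rpredZ ?mem1v.
have splitL : SplittingField.axiom L.
  exists (map_poly e q * map_poly (in_alg L) Q).
    rewrite rpredM //; apply/polyOverP=> i; rewrite coef_map /=.
    by rewrite rpredZ ?mem1v.
  exists (map e rs ++ ys).
    have eq_q : map_poly e q %= \prod_(y <- map e rs) ('X - y%:P).
      have := Dq; rewrite -(eqp_map e) rmorph_prod /= big_map.
      by under eq_bigr => y _ do rewrite map_polyXsubC.
    have eq_Q : map_poly (in_alg L) Q %= \prod_(y <- ys) ('X - y%:P).
      rewrite -(eqp_map jL) -map_poly_comp rmorph_prod /=.
      under [X in _ %= X]eq_bigr => y _ do rewrite map_polyXsubC.
      rewrite -(big_map jL xpredT (fun z => 'X - z%:P)) Dzs.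
      have jLj : jL \o in_alg L =1 j \o in_alg K.
        by move=> a /=; rewrite -jLe linearZ /= rmorph1.
      rewrite (eq_map_poly jLj) {1}DQ eqp_scale //.
      by rewrite lead_coef_eq0 map_poly_eq0.
    rewrite big_cat /=; apply: eqp_trans (eqp_mulr _ eq_q) _.
    exact: eqp_mull.
  have sEL : (limg e <= <<1 & map e rs ++ ys>>)%VS.
    rewrite -defK aimg_adjoin_seq aimg1; apply: adjoin_seqSr => y ey.
    by rewrite mem_cat ey.
  apply/eqP; rewrite eqEsubv subvf /= -[X in (X <= _)%VS]defL.
  apply/Fadjoin_seqP; split=> // y ys_y.
  by apply: seqv_sub_adjoin; rewrite mem_cat ys_y orbT.
exists (HB.pack_for (splittingFieldType k) L
          (FieldExt_isSplittingField.Build k L splitL)).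
exists e, jL; split=> // b /Qbs.
rewrite DQ rootZ ?lead_coef_eq0 ?map_poly_eq0 // root_prod_XsubC -Dzs.
by case/mapP=> y _ ->; exists y.
Qed.

End Extensions.

(** * Generated subfields of [kbar] and their images under embeddings *)

Section Subextensions.

Variables (k kbar : fieldType) (iota : {rmorphism k -> kbar}).
Implicit Types (A B M : kbar -> Prop).

Lemma subextensionD M x y : subextension iota M -> M x -> M y -> M (x + y).
Proof.
case=> Mb MB _ _ Mx My; rewrite -[y]opprK -[- y]sub0r; apply: (MB) => //.
by apply: (MB) => //; rewrite -(rmorph0 iota).
Qed.

Lemma subextension_horner M (q : {poly k}) x :
  subextension iota M -> M x -> M (map_poly iota q).[x].
Proof.
move=> subM Mx; have [Mb _ MM _] := subM; rewrite horner_coef.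
apply: (big_ind M); first by rewrite -(rmorph0 iota).
  by move=> y z; apply: subextensionD.
move=> i _; rewrite coef_map; apply: (MM _ _ (Mb _)).
elim: (i : nat) => [|n IHn]; first by rewrite expr0 -(rmorph1 iota).
by rewrite exprS; apply: (MM).
Qed.

Lemma adjoin_subextension A : subextension iota (adjoin iota A).
Proof.
split.
- by move=> a M [].
- move=> x y Ax Ay M subM AM; case: (subM) => _ MB _ _.
  by apply: MB; [apply: Ax | apply: Ay].
- move=> x y Ax Ay M subM AM; case: (subM) => _ _ MM _.
  by apply: MM; [apply: Ax | apply: Ay].
by move=> x Ax M subM AM; case: (subM) => _ _ _ MV; apply: MV; apply: Ax.
Qed.

Lemma adjoin_mono A B x : (forall y, A y -> B y) -> adjoin iota A x -> adjoin iota B x.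
Proof. by move=> sAB Ax M subM BM; apply: Ax => // y /sAB; apply: BM. Qed.

(** The elements generated by finitely many members of [A] form a subextension containing [A], so it
    contains [adjoin iota A]. *)
Lemma adjoin_finite A x : adjoin iota A x ->
  exists s : seq kbar, (forall y, y \in s -> A y) /\ adjoin iota (fun y => y \in s) x.
Proof.
pose adj (s : seq kbar) := adjoin iota (fun y => y \in s).
pose finA z := exists s, (forall y, y \in s -> A y) /\ adj s z.
have subadj s : subextension iota (adj s) := adjoin_subextension _.
have fin2 op : (forall s y z, adj s y -> adj s z -> adj s (op y z)) ->
    forall y z, finA y -> finA z -> finA (op y z).
  move=> adj_op y z [s1 [As1 s1y]] [s2 [As2 s2z]]; exists (s1 ++ s2); split.
    by move=> t; rewrite mem_cat => /orP[/As1|/As2].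
  apply: adj_op; [apply: adjoin_mono s1y | apply: adjoin_mono s2z];
    by move=> t s_t; rewrite mem_cat s_t ?orbT.
move=> /(_ finA); apply; last first.
  move=> y Ay; exists [:: y]; split=> [z | M _ My]; first by rewrite inE => /eqP->.
  by apply: My; rewrite inE.
split=> [a||| y [s [As sy]]].
- by exists [::]; split=> //; have [] := subadj [::].
- by apply: fin2 => s; have [] := subadj s.
- by apply: fin2 => s; have [] := subadj s.
by exists s; split=> //; have [_ _ _] := subadj s; apply.
Qed.

Lemma adjoin_finite_seq A (xs : seq kbar) : (forall x, x \in xs -> adjoin iota A x) ->
  exists s : seq kbar, (forall y, y \in s -> A y) /\
    forall x, x \in xs -> adjoin iota (fun y => y \in s) x.
Proof.
elim: xs => [|x xs IHxs] Axs; first by exists [::].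
have [|s [As sxs]] := IHxs; first by move=> y xs_y; apply: Axs; rewrite inE xs_y orbT.
have [|s1 [As1 s1x]] := @adjoin_finite A x; first by apply: Axs; rewrite mem_head.
exists (s1 ++ s); split=> [z | z]; first by rewrite mem_cat => /orP[/As1|/As].
rewrite inE => /predU1P[-> | /sxs]; [apply: adjoin_mono s1x | apply: adjoin_mono];
  by move=> y s_y; rewrite mem_cat s_y ?orbT.
Qed.

Variables (L : fieldExtType k) (j : {rmorphism L -> kbar}).
Hypothesis jE : forall a : k, j a%:A = iota a.

Lemma subextension_image (E : {subfield L}) :
  subextension iota (fun z => exists2 y, y \in E & j y = z).
Proof.
split=> [a | _ _ [x Ex <-] [y Ey <-] | _ _ [x Ex <-] [y Ey <-] | _ [x Ex <-]].
- by exists a%:A; rewrite ?rpredZ ?mem1v.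
- by exists (x - y); rewrite ?rpredB ?rmorphB.
- by exists (x * y); rewrite ?rpredM ?rmorphM.
by exists (x^-1); rewrite ?rpredV ?fmorphV.
Qed.

Lemma adjoin_image y z :
  adjoin iota (eq (j y)) z <-> exists2 u, u \in <<1; y>>%VS & j u = z.
Proof.
split=> [adj_z | [_ /Fadjoin_polyP[q Kq ->] <-] M subM Mjy].
  move/(_ _ (subextension_image <<1; y>>%AS)): adj_z; apply.
  by move=> _ <-; exists y => //; apply: memv_adjoin.
have /polyOver1P[q0 ->] := Kq.
rewrite -horner_map /= -map_poly_comp (eq_map_poly jE).
by apply: subextension_horner => //; apply: Mjy.
Qed.

(** The injection [j] carries [<<1; y>>] onto [adjoin iota (eq (j y))], so a basis of the latter
    pulls back to one of the former. *)
Lemma dim_adjoin_has_degree y n :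
  has_degree iota (adjoin iota (eq (j y))) n -> \dim <<1; y>> = n.
Proof.
case=> b [b_span b_free].
have b_img i : exists2 u, u \in <<1; y>>%VS & j u = b i.
  apply/adjoin_image/b_span; exists (fun i' => (i' == i)%:R).
  rewrite (bigD1 i) //= eqxx rmorph1 mul1r big1 ?addr0 // => i' /negPf->.
  by rewrite rmorph0 mul0r.
have [u uK ub] : exists2 u : 'I_n -> L,
    forall i, u i \in <<1; y>>%VS & forall i, j (u i) = b i.
  have [u uP] := fin_all_exists2 b_img; by exists u => i; have [] := uP i.
have j_comb (c : 'I_n -> k) : j (\sum_i c i *: u i) = \sum_i iota (c i) * b i.
  rewrite rmorph_sum; apply: eq_bigr => i _.
  by rewrite -mulr_algl rmorphM /= jE ub.
pose X := [tuple u i | i < n].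
have Xi (i : 'I_n) : X`_i = u i by rewrite -tnth_nth tnth_mktuple.
suffices /size_basis <- : basis_of <<1; y>> X by [].
apply/andP; split.
  rewrite eqEsubv; apply/andP; split.
    by apply/span_subvP=> _ /mapP[i _ ->].
  apply/subvP=> v Kv; have [|c jv] := (b_span (j v)).1.
    by apply/adjoin_image; exists v.
  have -> : v = \sum_i c i *: u i by apply: (fmorph_inj j); rewrite j_comb.
  by apply: rpred_sum => i _; rewrite rpredZ // memv_span // -Xi mem_nth ?size_tuple.
apply/freeP=> c; under eq_bigr => i _ do rewrite Xi.
by move/(congr1 j); rewrite j_comb rmorph0 => /b_free.
Qed.

End Subextensions.

(** * Elements of prime degree in a normal extension *)

Section DegreePrime.

Variables (k : fieldType) (L : splittingFieldType k).
Local Notation G := 'Gal({:L} / 1)%g.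

(** As [L] may be inseparable over [k], cosets are counted directly: [H :* x] is determined by the
    conjugate [x y], and the separable minimal polynomial of [y] has as many distinct roots as its
    degree. *)
Lemma index_gal_adjoin_separable (y : L) :
  separable_element 1 y -> #|G : 'Gal({:L} / <<1; y>>)|%g = \dim <<1; y>>.
Proof.
move=> sepy; have nG := normalFieldf (1%AS : {subfield L}).
have [r /subsetP Gr Dy] := normalField_factors (sub1v _) nG y (memvf y).
have Ur : uniq [seq x y | x : gal_of {:L} <- r].
  by rewrite -separable_prod_XsubC big_map -Dy.
have szr : size r = \dim <<1; y>>.
  have := size_minPoly 1 y; rewrite Dy size_prod_XsubC adjoin_degreeE dimv1 divn1.
  by case.
set H := 'Gal({:L} / <<1; y>>)%g.
have HP x : x \in G -> (x \in H) = (x y == y).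
  move=> Gx; rewrite gal_kHom ?subvf //; apply/kAHomP/eqP => [-> // | xy].
    exact: memv_adjoin.
  move=> _ /Fadjoin_polyP[q Kq ->]; rewrite -horner_map /= xy; congr _.[_].
  by rewrite (fixedPoly_gal _ Gx) ?sub1v.
have Hx x x' : x \in G -> x' \in G -> ((H :* x)%g == (H :* x')%g) = (x y == x' y).
  move=> Gx Gx'; rewrite (sameP eqP rcoset_eqP) mem_rcoset HP ?groupM ?groupV //.
  rewrite galM ?memvf //; apply/eqP/eqP=> [xy | ->].
    rewrite -[in RHS]xy.
    by rewrite -(galM x'^-1%g x') ?memvf // mulVg gal_id.
  by rewrite -(galM x' x'^-1%g) ?memvf // mulgV gal_id.
pose s := [seq (H :* x)%g | x : gal_of {:L} <- r].
have Us : uniq s.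
  (* Evaluating a representative at [y] recovers the root from the coset, so distinct roots give
     distinct cosets. *)
  pose ev (C : {set gal_of {:L}}) := (repr C : gal_of {:L}) y.
  apply: (@map_uniq _ _ ev).
  suff -> : map ev s = [seq x y | x : gal_of {:L} <- r] by [].
  rewrite -map_comp; apply/eq_in_map=> x rx; rewrite /= /ev.
  have sHG : H \subset G by rewrite galS ?sub1v.
  have Gx := Gr x rx.
  have Grx : repr (H :* x)%g \in G.
    have /rcosetP[h Hh ->] := mem_repr_rcoset [group of H] x.
    by rewrite groupM // (subsetP sHG).
  by apply/eqP; rewrite -Hx // rcoset_repr.
have <- : size s = \dim <<1; y>> by rewrite size_map.
rewrite -(card_uniqP Us); apply: eq_card => C.
apply/rcosetsP/mapP => [[x Gx ->] | [x rx ->]].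
  have : x y \in [seq x y | x : gal_of {:L} <- r].
    rewrite -root_prod_XsubC big_map -Dy.
    by rewrite -(fixedPoly_gal (sub1v _) Gx (minPolyOver 1 y)) fmorph_root root_minPoly.
  case/mapP=> x' rx' xy; exists x' => //.
  by apply/eqP; rewrite Hx ?(Gr _ rx') //; apply/eqP.
by exists x => //; apply: Gr.
Qed.

(** If [y] is separable, its stabilizer has index [p] and contains [g]. If not, some separable
    [y ^+ n], with [n] a power of the characteristic, generates a proper subfield of [k(y)], which
    is [k] because [p] is prime. *)
Lemma gal_fix_degree_prime (p : nat) (y : L) (g : gal_of {:L}) :
    prime p -> \dim <<1; y>> = p -> g \in G ->
    (forall H : {group gal_of {:L}}, H \subset G -> #|G : H|%g = p -> g \in H) ->
  g y = y.
Proof.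
move=> p_pr dimy Gg gH.
have [sepy | insepy] := boolP (separable_element 1 y).
  have := gH 'Gal({:L} / <<1; y>>)%G (galS _ (sub1v _)).
  rewrite index_gal_adjoin_separable // dimy => /(_ erefl).
  by move=> gal_g; apply: (fixed_gal (subvf _) gal_g (memv_adjoin 1 y)).
have [n /andP[charn sepyn]] := separable_exponent_pchar 1 y.
have syn : (<<1; y ^+ n>> <= <<1; y>>)%VS.
  by apply/FadjoinP; rewrite sub1v rpredX ?memv_adjoin.
have := field_dimS syn; rewrite dimy => dvdp.
have [_ /(_ _ dvdp)/orP[/eqP dim1 | /eqP dimp]] := primeP p_pr.
  have Fyn : y ^+ n \in 1%VS.
    by rewrite -adjoin_deg_eq1 adjoin_degreeE dim1 dimv1.
  apply/eqP; rewrite -subr_eq0.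
  (* Raising to the power [n] is additive, and [g] fixes [y ^+ n]. *)
  have : (g y - y) ^+ n == 0.
    rewrite exprDn_pchar // exprNn_pchar // -rmorphXn /=.
    by rewrite (fixed_gal (sub1v _) Gg Fyn) subrr.
  by rewrite expf_eq0 => /andP[].
case/negP: insepy; move/adjoin_separableP: sepyn; apply.
have -> : <<1; y ^+ n>>%VS = <<1; y>>%VS.
  by apply/eqP; rewrite eqEdim syn dimp dimy /=.
exact: memv_adjoin.
Qed.

End DegreePrime.

(** * Generators of a Galois subextension *)

Section Galois.

Variables (k : fieldType) (L : splittingFieldType k) (E : {subfield L}).
Hypothesis galE : galois 1 E.

(** Take bases of the fixed fields of all subgroups of index at most [c]. An automorphism fixing
    these elements lies in every such subgroup, hence is trivial. *)
Lemma galois_generators_le (c : nat) :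
    (forall y, y \in 'Gal(E / 1)%g -> y != 1%g ->
       exists H : {group gal_of E},
         [/\ H \subset 'Gal(E / 1)%g, (#|'Gal(E / 1) : H|%g <= c)%N & y \notin H]) ->
  exists s : seq L,
    <<1 & s>>%VS = E /\ {in s, forall x : L, (\dim <<1; x>> <= c)%N}.
Proof.
move=> sepE.
pose small (H : {group gal_of E}) :=
  (H \subset 'Gal(E / 1)%g) && (#|'Gal(E / 1) : H|%g <= c)%N.
pose s : seq L := flatten
  [seq (vbasis (fixedField H) : seq L) | H : {group gal_of E} <- enum small].
have sP x : x \in s -> exists2 H : {group gal_of E}, small H & x \in fixedField H.
  case/flatten_mapP=> H; rewrite mem_enum => smallH Hx; exists H => //.
  exact: vbasis_mem.
have sE : (<<1 & s>> <= E)%VS.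
  apply/Fadjoin_seqP; split=> [|x /sP[H _ Hx]]; first exact: sub1v.
  exact: (subvP (fixedField_bound _)) Hx.
exists s; split; last first.
  move=> x /sP[H /andP[sHG leHc] Hx]; apply: leq_trans leHc.
  have [] := (dim_fixed_galois galE sHG); rewrite dimv1 divn1 => <-.
  by apply: dimvS; apply/FadjoinP; rewrite sub1v.
have galsE : galois <<1 & s>> E by apply: galoisS galE; rewrite sub1v.
have triv : 'Gal(E / <<1 & s>>)%g = 1%g.
  apply/trivgP/subsetP=> y galy; rewrite inE; apply: contraT => nty.
  have Gy : y \in 'Gal(E / 1)%g by apply: (subsetP (galS E (sub1v _))) galy.
  have [H [sHG leHc]] := sepE y Gy nty; case/negP.
  rewrite -[H : {set _}](gal_fixedField H).
  have sHs : (fixedField H <= <<1 & s>>)%VS.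
    rewrite -{1}(span_basis (vbasisP (fixedField H))); apply/span_subvP=> x Hx.
    apply: seqv_sub_adjoin; apply/flatten_mapP; exists H => //.
    by rewrite mem_enum; apply/andP.
  exact: (subsetP (galS E sHs)) galy.
rewrite -[LHS](galois_fixedField galsE) triv.
apply/eqP; rewrite eqEsubv fixedField_bound; apply/subvP=> x Ex.
by apply/fixedFieldP=> // y /set1P->; rewrite gal_id.
Qed.

(** Restriction to [E] maps ['Gal({:L} / 1)] onto ['Gal(E / 1)] with kernel ['Gal({:L} / E)], so a
    subgroup separating a lift [x] of [y] from the kernel has an image that misses [y]. *)
Lemma galois_generators_index_p (p : nat) : prime p ->
    (forall g, g \in 'Gal({:L} / 1)%g ->
       (forall H : {group gal_of {:L}}, H \subset 'Gal({:L} / 1)%g ->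
          #|'Gal({:L} / 1) : H|%g = p -> g \in H) ->
       {in E, forall x, g x = x}) ->
  exists s : seq L,
    <<1 & s>>%VS = E /\ {in s, forall x : L, (\dim <<1; x>> <= p)%N}.
Proof.
move=> p_pr fixE; apply: galois_generators_le => y Gy nty.
have s1EL : (1 <= E <= {:L})%VS by rewrite sub1v subvf.
have nE : normalField 1 E by have /and3P[] := galE.
have lift z : z \in 'Gal(E / 1)%g -> {x | x \in 'Gal({:L} / 1)%g & {in E, z =1 x}}.
  by move=> Gz; apply: kHom_to_gal s1EL (normalFieldf _) _; rewrite -gal_kHom ?sub1v.
have [x Gx xy] := lift y Gy.
pose f := normalField_cast_morphism s1EL nE.
have fx : f x = y.
  apply/eqP/gal_eqP=> a Ea; rewrite xy //.
  exact: (normalField_cast_eq s1EL nE Gx Ea).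
have kerf : ('ker f = 'Gal({:L} / E))%g by apply: normalField_ker.
have nsN : ('Gal({:L} / E) <| 'Gal({:L} / 1))%g by rewrite -kerf ker_normal.
have N'x : x \notin 'Gal({:L} / E)%g.
  by apply: contra nty; rewrite -kerf -fx => /mker ->.
have [g Gg gH|H [sNH sHG leHp H'x]] := separate_small_index p_pr _ nsN Gx N'x.
  rewrite gal_kHom ?subvf //; apply/kAHomP; exact: fixE Gg gH.
have imf : (f @* 'Gal({:L} / 1) = 'Gal(E / 1))%g.
  apply/eqP; rewrite eqEsubset; apply/andP; split; apply/subsetP=> z.
    case/morphimP=> u Gu _ ->; rewrite gal_kHom ?sub1v //; apply/kAHomP=> a Fa.
    rewrite (normalField_cast_eq s1EL nE Gu) ?(subvP (sub1v E)) //.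
    exact: fixed_gal (sub1v _) Gu Fa.
  case/lift=> u Gu zu.
  apply/morphimP; exists u => //; apply/eqP/gal_eqP=> a Ea.
  by rewrite zu //; apply/esym/(normalField_cast_eq s1EL nE Gu Ea).
exists (f @* H)%G; split.
- by rewrite -imf morphimS.
- apply: leq_trans (dvdn_leq _ _) leHp; first exact: indexg_gt0.
  by rewrite -imf index_morphim // subsetIl.
apply: contra H'x; rewrite -fx => /morphimP[u Gu Hu xu].
have : (x * u^-1 \in 'ker f)%g.
  by apply/kerP; rewrite ?groupM ?groupV // (morphM f) ?groupV // (morphV f) // xu mulgV.
by rewrite kerf => /(subsetP sNH); rewrite groupMr ?groupV.
Qed.

End Galois.

(** * Transport along an embedding *)

Section Transfer.

Variables (k : fieldType) (K L : splittingFieldType k) (e : 'AHom(K, L)).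

(** Being the splitting field of a separable polynomial over [k] is preserved by [e]. *)
Lemma galois_limg : galois 1 {:K} -> galois 1 (e @: {:K}).
Proof.
move=> /splitting_galoisField[q [Kq sepq [rs Dq defK]]].
apply/splitting_galoisField; exists (map_poly e q); split.
- apply/polyOverP=> i; rewrite coef_map /=.
  by have /vlineP[a ->] := polyOverP Kq i; rewrite linearZ /= rmorph1 rpredZ ?mem1v.
- by rewrite separable_map.
exists (map e rs); last first.
  by have := congr1 (fun U => e @: U)%VS defK; rewrite aimg_adjoin_seq aimg1.
have := Dq; rewrite -(eqp_map e) rmorph_prod /= big_map.
by under eq_bigr => y _ do rewrite map_polyXsubC.
Qed.

Lemma generators_limg c :
    (exists s : seq L, <<1 & s>>%VS = (e @: {:K})%VS /\
       {in s, forall x : L, (\dim <<1; x>> <= c)%N}) ->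
  exists s : seq K,
    <<1 & s>>%VS = {:K}%VS /\ {in s, forall x : K, (\dim <<1; x>> <= c)%N}.
Proof.
case=> s [def_s le_s]; have inj_e := AHom_lker0 e.
have [t Dt] : exists t, s = map e t.
  have : {subset s <= (e @: {:K})%VS} by move=> x sx; rewrite -def_s seqv_sub_adjoin.
  elim: (s) => [|x s' IHs] s'E; first by exists [::].
  have [|t ->] := IHs; first by move=> y sy; rewrite s'E ?inE ?sy ?orbT.
  have /memv_imgP[y _ ->] := s'E x (mem_head _ _).
  by exists (y :: t).
exists t; split=> [|x tx].
  apply/eqP; rewrite eqEsubv subvf -(limg_ker0 _ _ inj_e) aimg_adjoin_seq aimg1 -Dt.
  by rewrite def_s subvv.
have := le_s (e x); rewrite Dt map_f // => /(_ isT).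
by rewrite -(aimg1 e) -aimg_adjoin limg_dim_eq // (eqP inj_e) capv0.
Qed.

End Transfer.

Lemma degree_compositum_generated_le (k : fieldType) (kbar : closedFieldType)
    (iota : {rmorphism k -> kbar})
    (kbar_algebraic : forall x : kbar, algebraicOver iota x)
    (p : nat) (p_prime : prime p) :
  galois_generated_le iota (degree_compositum iota p) p.
Proof.
move=> K j jE galK Kp.
have jKE : j \o in_alg K =1 iota by move=> a /=; rewrite jE.
(* Finitely many elements of degree [p] suffice, since [K] has a finite basis. *)
have [|bs [bs_deg bs_K]] := @adjoin_finite_seq _ _ iota
    (fun b => has_degree iota (adjoin iota (eq b)) p) (map j (vbasis {:K})).
  by move=> _ /mapP[x _ ->]; apply: Kp.
have [|L [e [jL [jLe jL_bs]]]] := @exists_splitting_extension k kbar K j bs.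
  move=> z; have [q nzq qz0] := kbar_algebraic z; exists q => //.
  by rewrite (eq_map_poly jKE).
have jLE a : jL a%:A = iota a by rewrite -jE -jLe linearZ /= rmorph1.
apply: (generators_limg (e := e)).
apply: (@galois_generators_index_p _ L (e @: {:K})%AS (galois_limg e galK) _ p_prime).
move=> g Gg gH.
(* The fixed field of [g] contains preimages of all the [bs], hence the image of [K]. *)
pose F := fixedField [set g].
have bs_fix : forall b, b \in bs -> exists2 y, y \in F & jL y = b.
  move=> b bs_b; have [y Dy] := jL_bs b bs_b; exists y => //.
  apply/fixedFieldP=> [|_ /set1P->]; first exact: memvf.
  apply: gal_fix_degree_prime p_prime _ Gg gH.
  by apply: (dim_adjoin_has_degree jLE); rewrite Dy; apply: bs_deg.
have sKF : (e @: {:K} <= F)%VS.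
  rewrite -(span_basis (vbasisP {:K})) limg_span; apply/span_subvP=> _ /mapP[x Kx ->].
  have jKx : j x \in map j (vbasis {:K}) by apply: map_f.
  have [y Fy] := bs_K _ jKx _ (subextension_image jLE F) bs_fix.
  by rewrite -jLe => /(fmorph_inj jL) <-.
by move=> x /(subvP sKF)/mem_fixedFieldP[_]; apply; rewrite inE.
Qed.

Theorem theorem5 (k : fieldType) (kbar : closedFieldType)
    (iota : {rmorphism k -> kbar})
    (kbar_algebraic : forall x : kbar, algebraicOver iota x)
    (p : nat) (p_prime : prime p) :
  galois_bounded iota (degree_compositum iota p) /\
  galois_generated_le iota (degree_compositum iota p) p.
Proof.
have gen_p := degree_compositum_generated_le kbar_algebraic p_prime.
split=> //; split; [exact: adjoin_subextension | by move=> x _ | by exists p].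
Qed.
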